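(* For every integer $n\ge 1$, the directed topological complexity of the directed $n$-sphere $\overrightarrow{S^n}$ satisfies $$\overrightarrow{\mathsf{TC}}(\overrightarrow{S^n})=2.$$
   Context: For a topological space $X$, let $PX$ denote the space of all continuous paths $\gamma:[0,1]\to X$ with the compact-open topology. A directed space ($d$-space) is a pair $(X,\overrightarrow{P}X)$ consisting of a topological space $X$ and a subspace $\overrightarrow{P}X\subseteq PX$ such that: (i) all constant paths are in $\overrightarrow{P}X$; (ii) $\overrightarrow{P}X$ is closed under pre-composition with non-decreasing continuous maps $r:[0,1]\to[0,1]$; (iii) $\overrightarrow{P}X$ is closed under concatenation. Elements of $\overrightarrow{P}X$ are called dipaths (directed paths). The pair is often denoted simply $X$. For a $d$-space $X$, let $$\Gamma_X=\{(x,y)\in X\times X\mid \exists\,\gamma\in\overrightarrow{P}X \text{ such that } \gamma(0)=x,\ \gamma(1)=y\}\subseteq X\times X,$$ with the subspace topology, and let $\chi:\overrightarrow{P}X\to\Gamma_X$, $\chi(\gamma)=(\gamma(0),\gamma(1))$, be the dipath space map. The directed topological complexity $\overrightarrow{\mathsf{TC}}(X)$ is the smallest natural number $k$ such that there exists a partition $\Gamma_X=A_1\sqcup\cdots\sqcup A_k$ into (pairwise) disjoint Euclidean Neighbourhood Retracts (ENRs), each of which admits a continuous map $\sigma_i:A_i\to\overrightarrow{P}X$ such that $\chi\circ\sigma_i$ is the inclusion $A_i\hookrightarrow\Gamma_X$. (This is the unreduced convention.) For $n\ge1$, the directed $n$-sphere $\overrightarrow{S^n}$ is the $d$-space whose underlying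 space is the boundary $\partial I^{n+1}$ of the unit cube $I^{n+1}=[0,1]^{n+1}\subseteq\mathbb{R}^{n+1}$, and whose dipaths are those continuous paths in $\partial I^{n+1}$ which are non-decreasing in each coordinate. *)

(* Defs.v *)
From HB Require Import structures.
From mathcomp Require Import all_boot all_order all_algebra.
From mathcomp Require Import all_classical all_reals all_analysis.
From mathcomp Require Import lra.

Set Implicit Arguments.
Unset Strict Implicit.
Unset Printing Implicit Defensive.

Import Order.TTheory GRing.Theory Num.Theory.
Import numFieldNormedType.Exports.

Local Open Scope classical_set_scope.
Local Open Scope ring_scope.

Definition unitI (R : realType) : Type :=
  set_type (`[0%R, 1%R]%classic : set R).

HB.instance Definition _ (R : realType) := Topological.on (unitI R).

Section unit_interval.
Context (R : realType).

Definition toR (t : unitI R) : R := set_val t.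

Lemma clampI_subproof (x : R) :
  Num.max 0 (Num.min x 1) \in (`[0%R, 1%R]%classic : set R).
Proof.
by rewrite inE/= in_itv/= le_max lexx/= ge_max ler01/= ge_min lexx orbT.
Qed.

(* Retraction of the real line onto [0, 1]; it lets one name a point of [0, 1]
   by a real number without carrying a proof. *)
Definition clampI (x : R) : unitI R :=
  exist _ (Num.max 0 (Num.min x 1)) (clampI_subproof x).

Definition I0 : unitI R := clampI 0.
Definition I1 : unitI R := clampI 1.

Lemma toR_clampI (x : R) : 0 <= x <= 1 -> toR (clampI x) = x.
Proof.
move=> /andP[x0 x1]; rewrite /toR set_valE /=.
by rewrite min_l // max_r.
Qed.

Lemma toR_bound (t : unitI R) : 0 <= toR t <= 1.
Proof.
by case: t => t ht; rewrite /toR set_valE /=; move: ht; rewrite inE/= in_itv.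
Qed.

Lemma toR_continuous : continuous toR.
Proof. exact: initial_continuous. Qed.

Lemma clampI_continuous : continuous clampI.
Proof.
apply: continuous_comp_initial => x /=.
have -> : set_val \o clampI = fun y : R => Num.max 0 (Num.min y 1).
  by apply/funext => y; rewrite /= set_valE.
apply: (@continuous_max _ _ (cst 0) (fun y : R => Num.min y 1)).
  exact: cvg_cst.
by apply: (@continuous_min _ _ id (cst 1)) => //; exact: cvg_cst.
Qed.

End unit_interval.

(* The library puts no global topology on [continuousType]: the alias carries
   the compact-open one. *)
Definition pathSpace (R : realType) (X : topologicalType) : Type :=
  continuousType (unitI R) X.

HB.instance Definition _ (R : realType) (X : topologicalType) :=
  Topological.copy (pathSpace R X)
    (initial_topology
       (id : continuousType (unitI R) X -> {compact-open, unitI R -> X})).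

Section concatenation.
Context (R : realType) (X : topologicalType).

Definition cst_path (x : X) : pathSpace R X := cst x.

Definition reparam_path (g : pathSpace R X)
  (r : continuousType (unitI R) (unitI R)) : pathSpace R X := g \o r.

Definition concat_fun (g h : pathSpace R X) (t : unitI R) : X :=
  if toR t <= 2^-1 then g (clampI (2 * toR t))
  else h (clampI (2 * toR t - 1)).

Lemma concat_continuous (g h : pathSpace R X) :
  g (I1 R) = h (I0 R) -> continuous (concat_fun g h).
Proof.
move=> gh.
have toRc := @toR_continuous R.
have half (f : pathSpace R X) (c : R) :
    continuous (fun t : unitI R => f (clampI (2 * toR t - c))).
  have affc : continuous (fun x : R => 2 * x - c).
    move=> x; apply: cvgB; last exact: cvg_cst.
    by apply: cvgM; [exact: cvg_cst | exact: cvg_id].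
  move=> t; apply: (@continuous_comp _ _ _ (fun t => clampI (2 * toR t - c)) f).
    apply: (@continuous_comp _ _ _ (fun t => 2 * toR t - c) (@clampI R)).
      apply: (@continuous_comp _ _ _ (@toR R) (fun x => 2 * x - c)).
        exact: toRc.
      exact: affc.
    exact: clampI_continuous.
  exact: cts_fun.
have g2 : continuous (fun t : unitI R => g (clampI (2 * toR t))).
  by under eq_fun do rewrite -[2 * _]subr0; exact: half.
have h2 := half h 1.
pose A := [set t : unitI R | toR t <= 2^-1].
pose B := [set t : unitI R | 2^-1 <= toR t].
have cA : closed A.
  by apply: (@preimage_closed _ _ (@toR R) [set x | x <= 2^-1]) => //;
    exact: closed_le.
have cB : closed B.
  by apply: (@preimage_closed _ _ (@toR R) [set x | 2^-1 <= x]) => //;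
    exact: closed_ge.
have ABT : A `|` B = setT.
  apply/seteqP; split=> // t _ /=; rewrite /A /B /=.
  by case: (leP (toR t) 2^-1) => [|/ltW]; [left | right].
apply/continuous_subspace_setT; rewrite -ABT; apply: withinU_continuous => //.
  apply: (@subspace_eq_continuous _ A _ (fun t => g (clampI (2 * toR t)))).
    by move=> t; rewrite inE /from_subspace /concat_fun => tA; rewrite ifT.
  exact: continuous_subspaceT.
apply: (@subspace_eq_continuous _ B _ (fun t => h (clampI (2 * toR t - 1)))).
  move=> t; rewrite inE /from_subspace /concat_fun => tB; case: ifPn => // tA.
  have -> : toR t = 2^-1 by apply/eqP; rewrite eq_le tA.
  by rewrite divff // subrr.
exact: continuous_subspaceT.
Qed.

Definition concat_path (g h : pathSpace R X) (gh : g (I1 R) = h (I0 R)) :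
  pathSpace R X := mkcts (concat_continuous gh).

End concatenation.

Record dSpace (R : realType) := DSpace {
  dcarrier :> topologicalType;
  dipath : set (pathSpace R dcarrier);
  dipath_cst : forall x : dcarrier, dipath (cst_path R x);
  dipath_reparam : forall (g : pathSpace R dcarrier)
    (r : continuousType (unitI R) (unitI R)),
    {homo r : s t / toR s <= toR t} -> dipath g -> dipath (reparam_path g r);
  dipath_concat : forall (g h : pathSpace R dcarrier)
    (gh : g (I1 R) = h (I0 R)),
    dipath g -> dipath h -> dipath (concat_path gh) }.

Arguments dipath {R} X : rename.

Section directed_complexity.
Context (R : realType) (X : dSpace R).

(* Usually written Gamma_X; as a type, it carries the subspace topology of
   X * X. *)
Definition reach : set (X * X)%type :=
  [set p | exists g : pathSpace R X,
    [/\ dipath X g, g (I0 R) = p.1 & g (I1 R) = p.2]].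

Lemma dipath_map_subproof (g : dipath X) :
  (set_val g (I0 R), set_val g (I1 R)) \in reach.
Proof. by rewrite inE; exists (set_val g); split=> //; exact: set_valP. Qed.

Definition dipath_map (g : dipath X) : reach :=
  exist _ (set_val g (I0 R), set_val g (I1 R)) (dipath_map_subproof g).

End directed_complexity.

Arguments reach {R} X _ : rename.

Definition homeomorphic (E F : topologicalType) : Prop :=
  exists (f : E -> F) (g : F -> E),
    [/\ continuous f, continuous g, cancel f g & cancel g f].

Definition retract_of (T : topologicalType) (Y U : set T) : Prop :=
  Y `<=` U /\
  exists r : T -> T, [/\ {within U, continuous r},
    (forall u, U u -> Y (r u)) & (forall y, Y y -> r y = y)].

Definition ENR (R : realType) (E : topologicalType) : Prop :=
  exists (m : nat) (Y : set 'rV[R]_m),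
    homeomorphic E Y /\ exists2 U : set 'rV[R]_m, open U & retract_of Y U.

Section dTC.
Context (R : realType) (X : dSpace R).

Definition has_section (A : set (reach X)) : Prop :=
  exists s : A -> dipath X,
    continuous s /\ forall a : A, dipath_map (s a) = set_val a.

(* Library partitions have nonempty blocks; dropping empty blocks only lowers
   k, so this does not affect the least k below. *)
Definition dTC_partition (k : nat) : Prop :=
  exists A : 'I_k -> set (reach X),
    [/\ partition [set: 'I_k] A [set: reach X],
        (forall i, ENR R (A i)) & (forall i, has_section (A i))].

Definition dTC_partitionb (k : nat) : bool := `[< dTC_partition k >].

(* None when there is no such k, i.e. when the complexity is infinite. *)
Definition dTC : option nat :=
  if pselect (exists k, dTC_partitionb k) is left ex then Some (ex_minn ex)
  else None.

End dTC.

Definition unit_cube (R : realType) (m : nat) : set 'rV[R]_m :=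
  [set x | forall i, 0 <= x ord0 i <= 1].

Arguments unit_cube : clear implicits.

Definition boundary (T : topologicalType) (A : set T) : set T :=
  closure A `\` A°.

Section directed_sphere.
Context (R : realType) (n : nat).

Definition cube_boundary : set 'rV[R]_n.+1 := boundary (unit_cube R n.+1).

Definition sphere_dipath : set (pathSpace R cube_boundary) :=
  [set g : pathSpace R cube_boundary | forall i : 'I_n.+1,
    {homo (fun t => set_val (g t) ord0 i) : s t / toR s <= toR t >-> s <= t}].

Lemma sphere_dipath_cst (x : cube_boundary) : sphere_dipath (cst_path R x).
Proof. by move=> i s t _ /=. Qed.

Lemma sphere_dipath_reparam (g : pathSpace R cube_boundary)
  (r : continuousType (unitI R) (unitI R)) :
  {homo r : s t / toR s <= toR t} -> sphere_dipath g ->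
  sphere_dipath (reparam_path g r).
Proof. by move=> rm gm i s t st /=; apply/gm/rm. Qed.

Lemma sphere_dipath_concat (g h : pathSpace R cube_boundary)
  (gh : g (I1 R) = h (I0 R)) :
  sphere_dipath g -> sphere_dipath h -> sphere_dipath (concat_path gh).
Proof.
move=> gm hm i s t st /=; rewrite /mkcts /concat_fun.
have /andP[s0 s1] := toR_bound s; have /andP[t0 t1] := toR_bound t.
case: (leP (toR s) 2^-1) => hs; case: (leP (toR t) 2^-1) => ht.
- by apply: gm; rewrite !toR_clampI; lra.
- apply: (@le_trans _ _ (set_val (g (I1 R)) ord0 i)).
    by apply: gm; rewrite /I1 !toR_clampI; lra.
  by rewrite gh; apply: hm; rewrite /I0 !toR_clampI; lra.
- by lra.
- by apply: hm; rewrite !toR_clampI; lra.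
Qed.

Definition dsphere : dSpace R :=
  DSpace sphere_dipath_cst sphere_dipath_reparam sphere_dipath_concat.

End directed_sphere.

Arguments cube_boundary : clear implicits.
Arguments sphere_dipath : clear implicits.

(* Main.v *)
Require Import Defs.
From mathcomp Require Import all_boot all_order all_algebra.
From mathcomp Require Import all_classical all_reals all_analysis.
From mathcomp Require Import lra.

Set Implicit Arguments.
Unset Strict Implicit.
Unset Printing Implicit Defensive.

Import Order.TTheory GRing.Theory Num.Theory.
Import numFieldNormedType.Exports.

Local Open Scope classical_set_scope.
Local Open Scope ring_scope.

(** The dipaths of the sphere are the coordinatewise non-decreasing paths in
the boundary of the cube, and both bounds on the complexity come from this
rigidity.

Reachability.  A point of the boundary has a coordinate equal to 0 or 1.  A
dipath from [x] to [y] exists iff [x <= y] and either some coordinate is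
constantly 0 or constantly 1 along the way ([x i = y i] is 0 or 1), or
[x i = 0] and [y j = 1] for two distinct coordinates [i], [j].  Indeed, when
neither holds, there is a single [i] with [x i = 0] and [y i = 1], while all
the other coordinates stay strictly between 0 and 1, so that the coordinate
[i] would have to jump from 0 to 1 ([reachP]).

Upper bound.  Raise the coordinates one after the other in a fixed order.  This
staircase depends continuously on its end points, and it stays in the boundary
if some coordinate is constantly 0 or 1, or if some [j] with [y j = 1] is
raised before some [i] with [x i = 0] ([stairs_boundary]).  Hence each reachable
pair is served by the increasing or by the decreasing order of the coordinates.
The first block consists of the pairs served by the increasing order, the second
one of the others ([has_section_ascent]).

Both blocks are ENRs. For each [i], the numbers [x i], [y i - x i] and
[1 - y i] are barycentric coordinates on the triangle [0 <= x i <= y i <= 1]. In the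
product of these triangles the reachable pairs, and the pairs of the first
block, form unions of cells, each cut out by the vanishing of two barycentric
coordinates. Lowering all barycentric coordinates by the distance [e] to such a
union, truncating at 0 and normalising in each triangle kills every coordinate
that was at most [e]; it therefore retracts a neighbourhood onto the union
([corner_complex_retract]). The second block is relatively open in the set of
reachable pairs, so it is an ENR as well.

Lower bound.  Suppose that there is a global section.  Take the points all of
whose coordinates are [e > 0], except for the [j]-th one, which is 0.  A dipath
issued from such a point keeps its [j]-th coordinate at 0 as long as no
coordinate reaches 1.  Letting [e] tend to 0, the dipath chosen from the lowest
vertex to the highest one has this property for all [j] at once: it stays at the
lowest vertex as long as no coordinate reaches 1, so it never leaves it
([no_global_section]).  The same fact shows that neither of the two blocks above
is empty. *)

(** * The boundary of the cube *)

Lemma continuous_pair (T U V : topologicalType) (f : T -> U) (g : T -> V) :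
  continuous f -> continuous g -> continuous (fun x => (f x, g x)).
Proof. by move=> cf cg x; apply: cvg_pair; [exact: cf | exact: cg]. Qed.

Lemma cvg_rV (R : realType) (T : Type) (F : set_system T) (m : nat)
    (f : T -> 'rV[R]_m) (v : 'rV[R]_m) : Filter F ->
  (forall j, f t ord0 j @[t --> F] --> v ord0 j) -> f t @[t --> F] --> v.
Proof.
move=> FF fv B [P vP PB].
suff : \forall t \near F, forall j, P ord0 j (f t ord0 j).
  by apply: filterS => t Pt; apply: PB => i j; rewrite ord1.
by apply: filter_forall => j; apply: fv; exact: vP.
Qed.

Lemma cube_boundaryP (R : realType) (n : nat) (x : 'rV[R]_n.+1) :
  cube_boundary R n x <->
  (forall i, 0 <= x ord0 i <= 1) /\ exists i, x ord0 i = 0 \/ x ord0 i = 1.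
Proof.
have closed_cube : closed (unit_cube R n.+1).
  have -> : unit_cube R n.+1 = \bigcap_i
      ((fun y : 'rV[R]_n.+1 => y ord0 i) @^-1` [set z : R | 0 <= z] `&`
       (fun y : 'rV[R]_n.+1 => y ord0 i) @^-1` [set z : R | z <= 1]).
    apply/seteqP; split=> y hy i; first by move=> _; apply/andP; exact: hy.
    by apply/andP; exact: hy.
  apply: closed_bigI => i _; apply: closedI.
    apply: preimage_closed; last exact: closed_ge.
    by move=> *; exact: coord_continuous.
  apply: preimage_closed; last exact: closed_le.
  by move=> *; exact: coord_continuous.
rewrite /cube_boundary /boundary -(closure_id _).1 //; split.
  move=> [xc xb]; split=> //; apply: contrapT => nx; apply: xb.
  have xi i : 0 < x ord0 i < 1.
    have /andP[x0 x1] := xc i; rewrite !lt_neqAle x0 x1 !andbT.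
    by apply/andP; split; apply/eqP => e; apply: nx; exists i; [left|right].
  suff : \forall y \near x, forall i, 0 <= (y : 'rV[R]_n.+1) ord0 i <= 1 by [].
  pose inI i (y : 'rV[R]_n.+1) : Prop := 0 <= y ord0 i <= 1.
  apply: (@filter_forall _ _ inI (nbhs x)) => i.
  have cxi : {for x, continuous (fun y : 'rV[R]_n.+1 => y ord0 i)}
    by exact: coord_continuous.
  have /andP[x0 x1] := xi i.
  have y0 : \forall y \near x, 0 < (y : 'rV[R]_n.+1) ord0 i.
    exact: cxi _ (lt_nbhsr x0).
  have y1 : \forall y \near x, (y : 'rV[R]_n.+1) ord0 i < 1.
    exact: cxi _ (lt_nbhsl x1).
  by apply: filterS2 y0 y1 => y /ltW ? /ltW ?; apply/andP.
move=> [xc [i xi]]; split=> // nx.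
(* a point with an extremal coordinate leaves the cube when that coordinate is
   shifted by plus or minus e / 2 *)
pose f (t : R) : 'rV[R]_n.+1 := x + t *: delta_mx ord0 i.
have f0 : f t @[t --> (0 : R)] --> x.
  have -> : x = f 0 by rewrite /f scale0r addr0.
  apply: cvgD; first exact: cvg_cst.
  by apply: cvgZr_tmp; exact: cvg_id.
have /nbhs_ballP[e /= e0 be] : nbhs (0 : R) (f @^-1` unit_cube R n.+1) :=
  f0 _ nx.
have fi t : f t ord0 i = x ord0 i + t by rewrite !mxE !eqxx mulr1.
have bt (t : R) : `|t| < e -> 0 <= x ord0 i + t <= 1.
  by move=> te; rewrite -fi; apply: be; rewrite /ball /= sub0r normrN.
have e2 : `|e / 2| < e by rewrite ger0_norm; lra.
have e2' : `|- (e / 2)| < e by rewrite normrN.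
by have /andP[? ?] := bt _ e2; have /andP[? ?] := bt _ e2'; case: xi; lra.
Qed.

(** * Pairs of points and staircases *)

(** Names of the barycentric coordinates on the triangles
[0 <= x i <= y i <= 1]: [(i, Some false)] stands for [x i], [(i, Some true)]
for [1 - y i], and [(i, None)] for [y i - x i]. *)
Definition wall (n : nat) := ('I_n.+1 * option bool)%type.

Section corners.
Context (R : realType) (n : nat).
Implicit Types (v w : wall n) (x y : 'rV[R]_n.+1) (rk : 'I_n.+1 -> 'I_n.+1).

Definition height w x y : R :=
  match w.2 with
  | Some false => x ord0 w.1
  | None => y ord0 w.1 - x ord0 w.1
  | Some true => 1 - y ord0 w.1
  end.

Definition corner (P : rel (wall n)) x y :=
  exists v w, [/\ P v w, height v x y = 0 & height w x y = 0].

(** For the pairs [(x, y)] at which both heights vanish, the first clause means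
that the coordinate [v.1] has the same extremal value in [x] and [y], the second
one that [x i = 0] and [y j = 1] where [j] comes before [i] in the order
given by [rk]. *)
Definition flow rk : rel (wall n) := fun v w =>
  [&& v.1 == w.1, v.2 == None & w.2 != None] ||
  [&& (rk w.1 < rk v.1)%N, v.2 == Some false & w.2 == Some true].

Lemma corner_flowP rk x y : corner (flow rk) x y <->
  (exists i, x ord0 i = y ord0 i /\ (x ord0 i = 0 \/ x ord0 i = 1)) \/
  (exists i j, [/\ (rk j < rk i)%N, x ord0 i = 0 & y ord0 j = 1]).
Proof.
split.
  move=> [[i a] [[j b] []]]; rewrite /height /=.
  case/orP => /and3P[/= ij /eqP-> hb].
    rewrite (eqP ij) => e; case: b hb => // -[] _ h; left; exists j.
      by split; [|right]; lra.
    by split; [|left]; lra.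
  by rewrite (eqP hb) => xi yj; right; exists i, j; split=> //; lra.
move=> [[i [xy xi]]|[i [j [ij xi yj]]]].
  exists (i, None); case: xi => xi;
    [exists (i, Some false) | exists (i, Some true)].
    by rewrite /flow /height /= eqxx; split=> //; lra.
  by rewrite /flow /height /= eqxx; split=> //; lra.
exists (i, Some false), (j, Some true).
by rewrite /flow /height /= ij orbT; split=> //; lra.
Qed.

Definition ramp (t : R) : R := toR (clampI t).

Lemma ramp_bound t : 0 <= ramp t <= 1. Proof. exact: toR_bound. Qed.

Lemma ramp_le0 t : t <= 0 -> ramp t = 0.
Proof.
by move=> t0; rewrite /ramp /toR set_valE /= min_l ?max_l //; lra.
Qed.

Lemma ramp_ge1 t : 1 <= t -> ramp t = 1.
Proof. by move=> t1; rewrite /ramp /toR set_valE /= min_r // max_r. Qed.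

Lemma ramp_homo : {homo ramp : s t / s <= t}.
Proof.
move=> s t st; rewrite /ramp /toR !set_valE /=.
by rewrite ge_max !le_max !lexx /= le_min !ge_min st lexx !orbT.
Qed.

Lemma ramp_continuous : continuous ramp.
Proof.
move=> t; apply: (@continuous_comp _ _ _ (@clampI R) (@toR R)).
  exact: clampI_continuous.
exact: toR_continuous.
Qed.

(** The coordinate [i] is raised during the time interval from
[rk i / n.+1] to [(rk i).+1 / n.+1]. *)
Definition stairs rk x y (t : R) : 'rV[R]_n.+1 :=
  \row_i (x ord0 i + ramp (n.+1%:R * t - (rk i)%:R) * (y ord0 i - x ord0 i)).

Lemma stairs0 rk x y : stairs rk x y 0 = x.
Proof.
by apply/rowP => i; rewrite mxE mulr0 ramp_le0 ?sub0r ?oppr_le0 ?ler0n //; lra.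
Qed.

Lemma stairs1 rk x y : stairs rk x y 1 = y.
Proof.
apply/rowP => i; rewrite mxE mulr1 ramp_ge1; first by lra.
by rewrite lerBrDr -natr1 addrC lerD2r ler_nat -ltnS.
Qed.

Lemma stairs_homo rk x y i : x ord0 i <= y ord0 i ->
  {homo (fun t => stairs rk x y t ord0 i) : s t / s <= t}.
Proof.
move=> xy s t st; rewrite !mxE lerD2l ler_wpM2r ?subr_ge0 //.
by apply: ramp_homo; rewrite lerD2r ler_wpM2l.
Qed.

(** Either some coordinate never leaves 0 or 1, or at each time one of two
coordinates is extremal: [j] has already been raised to 1, or [i] is still 0. *)
Lemma stairs_boundary rk x y t : cube_boundary R n x -> cube_boundary R n y ->
  (forall i, x ord0 i <= y ord0 i) -> corner (flow rk) x y ->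
  cube_boundary R n (stairs rk x y t).
Proof.
move=> /cube_boundaryP[xc _] /cube_boundaryP[yc _] xy /corner_flowP xyc.
apply/cube_boundaryP; split=> [i|].
  have := xc i; have := yc i; have := xy i.
  have := ramp_bound (n.+1%:R * t - (rk i)%:R); rewrite mxE.
  set r := ramp _; move: (x _ _) (y _ _) => a b; nra.
case: xyc => [[i [xyi xi]]|[i [j [ij xi yj]]]].
  by exists i; rewrite mxE -xyi subrr mulr0 addr0.
(* the coordinate j reaches 1 before the coordinate i leaves 0 *)
have [ti|ti] := leP (n.+1%:R * t) (rk i)%:R.
  by exists i; left; rewrite mxE xi ramp_le0; lra.
exists j; right; rewrite mxE ramp_ge1; first by lra.
have : (rk j).+1%:R <= (rk i)%:R :> R by rewrite ler_nat.
by rewrite -natr1; lra.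
Qed.

End corners.

Section coordinates.
Context (R : realType) (n : nat).

Definition coordinate (i : 'I_n.+1) (x : cube_boundary R n) : R :=
  set_val x ord0 i.

Lemma coordinate_continuous i : continuous (coordinate i).
Proof.
move=> x.
apply: (@continuous_comp _ _ _ set_val (fun y : 'rV[R]_n.+1 => y ord0 i)).
  exact: initial_continuous.
exact: coord_continuous.
Qed.

End coordinates.

(** * The staircase sections *)

Section staircases.
Context (R : realType) (n : nat) (rk : 'I_n.+1 -> 'I_n.+1).
Implicit Types (x y : cube_boundary R n).

Definition ascent : set (cube_boundary R n * cube_boundary R n) :=
  [set p : cube_boundary R n * cube_boundary R n |
    (forall i, set_val p.1 ord0 i <= set_val p.2 ord0 i) /\
           corner (flow rk) (set_val p.1) (set_val p.2)].

Lemma stairs_subproof (p : ascent * unitI R) :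
  stairs rk (set_val (set_val p.1).1) (set_val (set_val p.1).2) (toR p.2)
    \in cube_boundary R n.
Proof.
have [xy xyc] := set_valP p.1.
by apply/mem_set/stairs_boundary => //; exact: set_valP.
Qed.

Definition stairs_fun (p : ascent * unitI R) : cube_boundary R n :=
  exist _
    (stairs rk (set_val (set_val p.1).1) (set_val (set_val p.1).2) (toR p.2))
    (stairs_subproof p).

(** Joint continuity in the end points and in time; by currying it gives both
the continuity of each staircase and that of the section. *)
Lemma stairs_fun_continuous : continuous stairs_fun.
Proof.
have cin : continuous (fun p : ascent * unitI R => set_val p.1).
  move=> p; apply: (@continuous_comp _ _ _ fst set_val); first exact: cvg_fst.
  exact: initial_continuous.
have ct : continuous (fun p : ascent * unitI R => toR p.2).
  move=> p; apply: (@continuous_comp _ _ _ snd (@toR R)); first exact: cvg_snd.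
  exact: toR_continuous.
apply: continuous_comp_initial => p.
apply: cvg_rV => j /=; rewrite set_valE /= mxE.
under eq_cvg do rewrite mxE.
have cx : (set_val (set_val q.1).1 : 'rV[R]_n.+1) ord0 j @[q --> p] -->
    (set_val (set_val p.1).1 : 'rV[R]_n.+1) ord0 j.
  apply: (@continuous_comp _ _ _ (fun q : ascent * unitI R => (set_val q.1).1)
    (coordinate j)); last exact: coordinate_continuous.
  by apply: (@continuous_comp _ _ _ _ fst); [exact: cin | exact: cvg_fst].
have cy : (set_val (set_val q.1).2 : 'rV[R]_n.+1) ord0 j @[q --> p] -->
    (set_val (set_val p.1).2 : 'rV[R]_n.+1) ord0 j.
  apply: (@continuous_comp _ _ _ (fun q : ascent * unitI R => (set_val q.1).2)
    (coordinate j)); last exact: coordinate_continuous.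
  by apply: (@continuous_comp _ _ _ _ snd); [exact: cin | exact: cvg_snd].
apply: cvgD; first exact: cx.
apply: cvgM; last exact: cvgB.
apply: (@continuous_comp _ _ _
  (fun q : ascent * unitI R => n.+1%:R * toR q.2 - (rk j)%:R) (@ramp R));
  last exact: ramp_continuous.
by apply: cvgB; [apply: cvgM; [exact: cvg_cst|exact: ct] | exact: cvg_cst].
Qed.

Definition stairs_path (a : ascent) : pathSpace R (dsphere R n) :=
  mkcts ((continuous_curry stairs_fun_continuous).2 a).

Lemma stairs_path_dipath a : stairs_path a \in dipath (dsphere R n).
Proof.
apply/mem_set => i s t st /=; rewrite !set_valE /=.
by apply: stairs_homo => //; exact: (set_valP a).1.
Qed.

Definition stairs_dipath (a : ascent) : dipath (dsphere R n) :=
  exist _ (stairs_path a) (stairs_path_dipath a).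

Lemma stairs_dipath_continuous : continuous stairs_dipath.
Proof.
apply: continuous_comp_initial; apply: continuous_comp_initial.
exact: continuous_curry_fun stairs_fun_continuous.
Qed.

Lemma stairs_dipath0 a : set_val (stairs_dipath a) (I0 R) = (set_val a).1.
Proof.
by apply: val_inj; rewrite /= /I0 /curry /= toR_clampI ?lexx ?ler01 // stairs0.
Qed.

Lemma stairs_dipath1 a : set_val (stairs_dipath a) (I1 R) = (set_val a).2.
Proof.
by apply: val_inj; rewrite /= /I1 /curry /= toR_clampI ?lexx ?ler01 // stairs1.
Qed.

Lemma ascent_reach p : ascent p -> reach (dsphere R n) p.
Proof.
move=> pa; pose a : ascent := exist _ p (mem_set pa).
exists (set_val (stairs_dipath a)).
by rewrite stairs_dipath0 stairs_dipath1; split=> //; exact: set_valP.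
Qed.

Lemma has_section_ascent (A : set (reach (dsphere R n))) :
  (forall p, A p -> ascent (set_val p)) -> has_section A.
Proof.
move=> hA.
have Aa (a : A) : set_val (set_val a) \in ascent.
  by apply/mem_set/hA/set_valP.
pose f (a : A) : ascent := exist _ (set_val (set_val a)) (Aa a).
exists (stairs_dipath \o f); split=> [a|a].
  apply: continuous_comp; last exact: stairs_dipath_continuous.
  move: a; apply: continuous_comp_initial => a.
  by apply: (@continuous_comp _ _ _ set_val set_val); exact: initial_continuous.
have e : set_val (dipath_map ((stairs_dipath \o f) a)) = set_val (set_val a).
  rewrite /dipath_map set_valE /= stairs_dipath0 stairs_dipath1 /=.
  exact: esym (surjective_pairing _).
exact: val_inj e.
Qed.

End staircases.

(** * Reachable pairs *)

Lemma unitI_IVT (R : realType) (f : unitI R -> R) (v : R) : continuous f ->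
  f (I0 R) <= v <= f (I1 R) -> exists t, f t = v.
Proof.
move=> cf /andP[f0 f1].
have ch : {within `[0, 1], continuous (f \o @clampI R)}.
  apply: continuous_subspaceT => s.
  by apply: continuous_comp; [exact: clampI_continuous | exact: cf].
have [|s _ fs] := IVT ler01 ch (v := v); last by exists (clampI s).
by rewrite /= ge_min le_max f0 f1 orbT.
Qed.

Section reachability.
Context (R : realType) (n : nat).

Lemma path_coordinate_continuous (g : pathSpace R (cube_boundary R n)) i :
  continuous (fun t => coordinate i (g t)).
Proof.
move=> t; apply: (@continuous_comp _ _ _ g (coordinate i)).
  exact: cts_fun.
exact: coordinate_continuous.
Qed.

Lemma toR_I0 : toR (I0 R) = 0. Proof. by rewrite toR_clampI ?lexx ?ler01. Qed.

Lemma toR_I1 : toR (I1 R) = 1. Proof. by rewrite toR_clampI ?lexx ?ler01. Qed.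

Lemma dipath_ge_start (g : pathSpace R (dsphere R n)) i t :
  dipath (dsphere R n) g -> coordinate i (g (I0 R)) <= coordinate i (g t).
Proof.
by move=> gd; apply: gd; rewrite toR_I0; have /andP[] := toR_bound t.
Qed.

Lemma dipath_le_end (g : pathSpace R (dsphere R n)) i t :
  dipath (dsphere R n) g -> coordinate i (g t) <= coordinate i (g (I1 R)).
Proof.
by move=> gd; apply: gd; rewrite toR_I1; have /andP[] := toR_bound t.
Qed.

Lemma coordinate_bound i (x : cube_boundary R n) : 0 <= coordinate i x <= 1.
Proof. by have /cube_boundaryP[+ _] := set_valP x; apply. Qed.

Lemma coordinate_extremal (x : cube_boundary R n) :
  exists i, coordinate i x = 0 \/ coordinate i x = 1.
Proof. by have /cube_boundaryP[_] := set_valP x. Qed.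

(** If [x <= y] and neither order of the coordinates serves [(x, y)], then one
coordinate [i] has to go from 0 to 1 while all the others stay strictly between
0 and 1: where the coordinate [i] takes the value 1/2, the path is not in the
boundary. *)
Lemma reachP (p : cube_boundary R n * cube_boundary R n) :
  reach (dsphere R n) p <-> ascent id p \/ ascent (@rev_ord n.+1) p.
Proof.
split; last by case; exact: ascent_reach.
case: p => x y [g [gd /= gx gy]].
have xy i : coordinate i x <= coordinate i y.
  by rewrite -gx -gy; apply: dipath_le_end.
suff : corner (flow id) (set_val x) (set_val y) \/
       corner (flow (@rev_ord n.+1)) (set_val x) (set_val y).
  by case; [left|right].
apply: contrapT => /not_orP[nid nrev].
have nstay i : ~ (coordinate i x = coordinate i y /\
    (coordinate i x = 0 \/ coordinate i x = 1)).
  by move=> h; apply: nid; apply/corner_flowP; left; exists i.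
have ndiff i j : i != j -> coordinate i x = 0 -> coordinate j y <> 1.
  move=> ij xi yj; have [ji|ji|/val_inj ji] := ltngtP (j : nat) i.
  - by apply: nid; apply/corner_flowP; right; exists i, j.
  - apply: nrev; apply/corner_flowP; right; exists i, j; split=> //=.
    by rewrite ltn_sub2l // ltnS (leq_trans ji) // -ltnS.
  - by rewrite ji eqxx in ij.
have x1 i : coordinate i x < 1.
  have /andP[_ ] := coordinate_bound i x; rewrite le_eqVlt => /orP[/eqP e|//].
  exfalso; apply: (nstay i); split; last by right.
  by have /andP[_] := coordinate_bound i y; have := xy i; lra.
have y0 i : 0 < coordinate i y.
  have /andP[+ _] := coordinate_bound i y; rewrite le_eqVlt => /orP[/eqP e|//].
  exfalso; apply: (nstay i).
  by have /andP[+ _] := coordinate_bound i x; have := xy i; lra.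
have [i xi] := coordinate_extremal x; have [j yj] := coordinate_extremal y.
have {}xi : coordinate i x = 0 by case: xi => // e; have := x1 i; lra.
have {}yj : coordinate j y = 1 by case: yj => // e; have := y0 j; lra.
have ij : i = j by apply/eqP/negPn/negP => /ndiff; exact.
have [t gt] : exists t, coordinate i (g t) = 2^-1.
  apply: unitI_IVT; first exact: path_coordinate_continuous.
  by rewrite gx gy ij yj -ij xi; lra.
have [k gk] := coordinate_extremal (g t).
have ki : k != i by apply/eqP => e; move: gk; rewrite e gt; lra.
have := dipath_ge_start k t gd; have := dipath_le_end k t gd; rewrite gx gy.
have /andP[xk _] := coordinate_bound k x.
have /andP[_ yk] := coordinate_bound k y.
case: gk => -> h1 h2.
  by apply: (ndiff k i ki); [lra | rewrite ij].
by apply: (ndiff i k); [rewrite eq_sym | | lra].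
Qed.

End reachability.

(** * There is no global section *)

Section evaluation.
Context (R : realType) (X : dSpace R).

Lemma dipath_eval_continuous (t : unitI R) :
  continuous (fun g : dipath X => set_val g t).
Proof.
move=> g O; rewrite nbhsE => -[B [oB Bg] BO].
pose eta (h : pathSpace R X) : {compact-open, unitI R -> X} := h.
have cg : eta (set_val h) @[h --> g] --> eta (set_val g).
  apply: (@continuous_comp _ _ _ set_val eta); first exact: initial_continuous.
  exact: initial_continuous.
have ct : compact [set t] by exact: compact_set1.
have FF : Filter (eta (set_val h) @[h --> g]).
  by apply: fmap_filter; exact: nbhs_filter.
have hB := (compact_open_cvgP _ FF).1 cg.
suff : \forall h \near g, eta (set_val h) @` [set t] `<=` B.
  by apply: filterS => h hB'; apply/BO/hB'; exists t.
by apply: (hB _ _ ct oB) => _ [_ -> <-].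
Qed.

End evaluation.

Section lower_bound.
Context (R : realType) (n : nat).
Context (n_gt0 : (0 < n)%N).

(** [ramp] truncates [e] to [0, 1], so that the point is in the boundary for all
real [e]. *)
Definition near_origin (j : 'I_n.+1) (e : R) : 'rV[R]_n.+1 :=
  \row_k (if k == j then 0 else ramp e).

Lemma near_origin_boundary j e : near_origin j e \in cube_boundary R n.
Proof.
apply/mem_set/cube_boundaryP; split=> [i|]; last first.
  by exists j; left; rewrite mxE eqxx.
by rewrite mxE; case: ifP => _; [rewrite lexx ler01 | exact: ramp_bound].
Qed.

Lemma top_boundary : const_mx 1 \in cube_boundary R n.
Proof.
apply/mem_set/cube_boundaryP; split=> [i|]; first by rewrite mxE lexx ler01.
by exists ord0; right; rewrite mxE.
Qed.

Definition probe_pair j e : cube_boundary R n * cube_boundary R n :=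
  (exist _ (near_origin j e) (near_origin_boundary j e),
   exist _ (const_mx 1 : 'rV[R]_n.+1) top_boundary).

(** This is where [n > 0] matters: a coordinate other than [j] is needed to go
up to 1 while the [j]-th one is 0. *)
Lemma probe_reach j e : probe_pair j e \in reach (dsphere R n).
Proof.
have le1 i : near_origin j e ord0 i <= (const_mx 1 : 'rV[R]_n.+1) ord0 i.
  rewrite !mxE; case: ifP => _; first exact: ler01.
  by have /andP[] := ramp_bound e.
have [k kj] : exists k : 'I_n.+1, k != j.
  have [->|j0] := eqVneq j ord0.
    by exists ord_max; rewrite -val_eqE /= -lt0n.
  by exists ord0; rewrite eq_sym.
apply/mem_set/reachP; have [kj'|jk|/val_inj e'] := ltngtP (k : nat) j.
- left; split=> //; apply/corner_flowP; right; exists j, k.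
  by rewrite /= !mxE eqxx.
- right; split=> //; apply/corner_flowP; right; exists j, k.
  rewrite /= !mxE eqxx; split=> //.
  by rewrite ltn_sub2l // ltnS (leq_trans jk) // -ltnS.
- by rewrite e' eqxx in kj.
Qed.

Definition probe j e : reach (dsphere R n) :=
  exist _ (probe_pair j e) (probe_reach j e).

Lemma probe_continuous j : continuous (probe j).
Proof.
apply: continuous_comp_initial.
apply: (@continuous_pair _ _ _ (fun e => (probe_pair j e).1)
  (fun=> (probe_pair j 0).2)) => [|e]; last exact: cvg_cst.
apply: continuous_comp_initial => e; apply: cvg_rV => i /=.
under eq_cvg do rewrite set_valE /= mxE.
rewrite set_valE /= mxE; case: ifP => _; first exact: cvg_cst.
exact: ramp_continuous.
Qed.

Lemma probe0 i j : probe i 0 = probe j 0.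
Proof.
have ij : near_origin i 0 = near_origin j 0.
  by apply/rowP => k; rewrite !mxE ramp_le0 // !if_same.
apply: val_inj; congr (_, _); exact: val_inj.
Qed.

(** The pairs [probe j e] are distinct for [e > 0] and coincide at [e = 0]: the
dipath [gamma] chosen there inherits the constraints of all the [j], which
prevents it from leaving the lowest vertex before some coordinate reaches 1. *)
Lemma no_global_section : ~ has_section [set: reach (dsphere R n)].
Proof.
move=> [s [cs hs]].
pose arg j e : [set: reach (dsphere R n)] := exist _ (probe j e) (mem_set I).
have carg j : continuous (arg j).
  by apply: continuous_comp_initial; exact: probe_continuous.
pose g j e : pathSpace R (cube_boundary R n) := set_val (s (arg j e)).
have gd j e : dipath (dsphere R n) (g j e) by exact: set_valP.
have g0 j e : g j e (I0 R) = (probe_pair j e).1.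
  by have /(congr1 (fun p => (set_val p).1)) := hs (arg j e).
have g1 j e : g j e (I1 R) = (probe_pair j e).2.
  by have /(congr1 (fun p => (set_val p).2)) := hs (arg j e).
have cg j t i : continuous (fun e => coordinate i (g j e t)).
  move=> e; apply: (@continuous_comp _ _ _ (fun e => g j e t) (coordinate i));
    last exact: coordinate_continuous.
  apply: (@continuous_comp _ _ _ (s \o arg j)
      (fun h : dipath (dsphere R n) => set_val h t));
    last exact: dipath_eval_continuous.
  by apply: continuous_comp; [exact: carg | exact: cs].
pose gamma := g ord0 0.
have gammaE j : g j 0 = gamma.
  by rewrite /gamma /g; congr (set_val (s _)); apply: val_inj; exact: probe0.
have stuck t : (forall i, coordinate i (gamma t) < 1) ->
    forall j, coordinate j (gamma t) = 0.
  move=> lt1 j; apply/eqP/negPn/negP => nz.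
  have gt0 : 0 < coordinate j (gamma t).
    have /andP[ge0 _] := coordinate_bound j (gamma t).
    by rewrite lt_neqAle eq_sym nz.
  have near1 : \forall e \near (0 : R), forall i, coordinate i (g j e t) < 1.
    pose below i e : Prop := coordinate i (g j e t) < 1.
    apply: (@filter_forall _ _ below (nbhs (0 : R))) => i.
    have lt1i : coordinate i (g j 0 t) < 1 by rewrite gammaE.
    exact: (cg j t i 0 _ (lt_nbhsl lt1i)).
  have near0 : \forall e \near (0 : R), 0 < coordinate j (g j e t).
    have gt0j : 0 < coordinate j (g j 0 t) by rewrite gammaE.
    exact: (cg j t j 0 _ (lt_nbhsr gt0j)).
  have [d /= d0 hd] := (nbhs_ballP _ _).1 (filterI near1 near0).
  (* [d / 2] is a positive value of [e] close enough to 0 *)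
  have [h1 h0] : (forall i, coordinate i (g j (d / 2) t) < 1) /\
      0 < coordinate j (g j (d / 2) t).
    by apply: hd; rewrite /ball /= sub0r normrN gtr0_norm; lra.
  have [k hk] := coordinate_extremal (g j (d / 2) t).
  have [kj|kj] := eqVneq k j; first by move: hk (h1 k); rewrite kj; lra.
  have := dipath_ge_start k t (gd j (d / 2)).
  rewrite g0 /coordinate set_valE /= mxE (negbTE kj).
  have := h1 k; move: hk; rewrite /coordinate set_valE.
  have : 0 < ramp (d / 2); last by lra.
  rewrite /ramp /toR set_valE /= lt_max lt_min.
  by apply/orP; right; apply/andP; lra.
(* The sum of the coordinates goes from 0 to at least 1; where it is 1/2, no
   coordinate is 1. *)
have [t ht] : exists t, \sum_i coordinate i (gamma t) = 2^-1.
  apply: unitI_IVT.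
    apply: continuous_big => [|i _]; first exact: add_continuous.
    exact: path_coordinate_continuous.
  rewrite /gamma g0 g1 big1 => [|i _]; last first.
    by rewrite /coordinate set_valE /= mxE ramp_le0 // if_same.
  rewrite (bigD1 ord0) //= {1}/coordinate set_valE /= mxE.
  set y := exist _ _ _.
  have : 0 <= \sum_(i < n.+1 | i != ord0) coordinate i y.
    by apply: sumr_ge0 => i _; have /andP[] := coordinate_bound i y.
  by lra.
have lt1 i : coordinate i (gamma t) < 1.
  have := ht; rewrite (bigD1 i) //=.
  have : 0 <= \sum_(k < n.+1 | k != i) coordinate k (gamma t).
    by apply: sumr_ge0 => k _; have /andP[] := coordinate_bound k (gamma t).
  by lra.
by move: ht; rewrite big1 => [|i _]; [lra | exact: stuck].
Qed.

End lower_bound.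

(** * Neighbourhood retractions onto unions of cells *)

Section complexes.
Context (R : realType) (n : nat).
Local Notation V := 'rV[R]_(n.+1 + n.+1).
Implicit Types (v w : wall n) (p : V) (P : rel (wall n)).

Definition pair_height w p : R := height w (lsubmx p) (rsubmx p).

Definition corner_complex P : set V :=
  [set p | (forall w, 0 <= pair_height w p) /\ corner P (lsubmx p) (rsubmx p)].

(** On the product of the triangles this measures, in barycentric coordinates,
how far [p] is from the nearest cell of [corner_complex P]. The default value 1
lies above all thresholds put on [gap]. *)
Definition gap P p : R :=
  \big[Num.min/1]_(vw : wall n * wall n | P vw.1 vw.2)
    Num.max (pair_height vw.1 p) (pair_height vw.2 p).

Lemma pair_height_continuous w : continuous (pair_height w).
Proof.
have cl i : continuous (fun p : V => lsubmx p ord0 i).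
  by move=> p; under eq_fun do rewrite mxE; exact: coord_continuous.
have cr i : continuous (fun p : V => rsubmx p ord0 i).
  by move=> p; under eq_fun do rewrite mxE; exact: coord_continuous.
case: w => i [[]|].
- have : continuous (fun p : V => 1 - rsubmx p ord0 i); last by [].
  by move=> p; apply: continuousB; [exact: cst_continuous | exact: cr].
- exact: cl.
- suff : continuous (fun p : V => rsubmx p ord0 i - lsubmx p ord0 i) by [].
  by move=> p; apply: continuousB; [exact: cr | exact: cl].
Qed.

Lemma gap_continuous P : continuous (gap P).
Proof.
apply: continuous_big => [|[v w] _].
  move=> z.
  apply: (@continuous_min R (R * R)%type (@fst R R) (@snd R R)).
    exact: cvg_fst.
  exact: cvg_snd.
move=> p.
apply: (@continuous_max _ _ (pair_height v) (pair_height w));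
  exact: pair_height_continuous.
Qed.

Lemma gap_leP P p (e : R) : e < 1 -> gap P p <= e <->
  exists v w, [/\ P v w, pair_height v p <= e & pair_height w p <= e].
Proof.
move=> e1; split.
  move=> /bigmin_leP[|[[v w] Pvw]]; first by rewrite leNgt e1.
  by rewrite ge_max => /andP[ve we]; exists v, w.
move=> [v [w [Pvw ve we]]]; apply/bigmin_leP; right.
by exists (v, w) => //; rewrite ge_max ve we.
Qed.

Lemma corner_complexP P p :
  corner_complex P p <-> (forall w, 0 <= pair_height w p) /\ gap P p <= 0.
Proof.
split=> -[h0 hP]; split=> //.
  apply/gap_leP; first exact: ltr01.
  by have [v [w [Pvw ve we]]] := hP; exists v, w; rewrite /pair_height ve we.
have /gap_leP[|v [w [Pvw ve we]]] := hP; first exact: ltr01.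
exists v, w; split=> //; apply/eqP; rewrite eq_le; apply/andP; split=> //;
  exact: h0.
Qed.

Definition excess (e : R) w p : R := Num.max (pair_height w p - e) 0.

Definition total_excess (e : R) (i : 'I_n.+1) p : R :=
  excess e (i, Some false) p + excess e (i, None) p + excess e (i, Some true) p.

(** The point with barycentric coordinates [excess e w p], normalised in each
triangle; it lies in all the facets at barycentric height at most [e] from
[p]. *)
Definition squeeze (e : R) p : V :=
  row_mx
    (\row_i (excess e (i, Some false) p / total_excess e i p))
    (\row_i ((excess e (i, Some false) p + excess e (i, None) p) /
             total_excess e i p)).

(** The three barycentric coordinates add up to 1 even outside the triangle, so
one of them is at least 1/3. *)
Lemma total_excess_gt0 e i p : e < 3^-1 -> 0 < total_excess e i p.
Proof.
move=> e3.
have sum1 : pair_height (i, Some false) p + pair_height (i, None) p +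
    pair_height (i, Some true) p = 1 by rewrite /pair_height /height /=; lra.
have ge w : pair_height w p - e <= excess e w p by rewrite le_max lexx.
have := ge (i, Some false); have := ge (i, None); have := ge (i, Some true).
by rewrite /total_excess; lra.
Qed.

Lemma pair_height_squeeze e w p : e < 3^-1 ->
  pair_height w (squeeze e p) = excess e w p / total_excess e w.1 p.
Proof.
case: w => i s e3; have /lt0r_neq0 t0 := total_excess_gt0 i p e3.
rewrite /pair_height /height row_mxKl row_mxKr !mxE /=.
apply: (mulIf t0); rewrite divfK //.
by case: s => [[]|]; rewrite ?mulrBl ?divfK ?mul1r //= /total_excess; lra.
Qed.

(** The size of the squeeze is the gap to the complex: it is large enough to
push [p] into a cell, and it vanishes on the complex, whose points are fixed. *)
Definition retraction P p : V := squeeze (Num.max 0 (gap P p)) p.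

Definition collar P : set V := [set p | gap P p < 3^-1].

Lemma collar_small P p : collar P p -> Num.max 0 (gap P p) < 3^-1.
Proof. by rewrite /collar /= => h; rewrite gt_max h andbT; lra. Qed.

Lemma collar_open P : open (collar P).
Proof.
apply: (@open_comp _ _ (gap P) [set t | t < 3^-1]); last exact: open_lt.
by move=> p _; exact: gap_continuous.
Qed.

Lemma retraction_in P p : collar P p -> corner_complex P (retraction P p).
Proof.
move=> /collar_small; set e := Num.max 0 _ => e3.
have e1 : e < 1 by lra.
apply/corner_complexP; split=> [w|].
  rewrite pair_height_squeeze // divr_ge0 ?(ltW (total_excess_gt0 _ _ _)) //.
  by rewrite /excess le_max lexx orbT.
have /gap_leP[//|v [w [Pvw ve we]]] : gap P p <= e by rewrite le_max lexx orbT.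
apply/gap_leP; first exact: ltr01.
exists v, w; split=> //;
  by rewrite pair_height_squeeze // /excess max_r ?mul0r // subr_le0.
Qed.

Lemma retraction_id P p : corner_complex P p -> retraction P p = p.
Proof.
move=> /corner_complexP[h0 g0]; rewrite /retraction max_l //.
have ex w : excess 0 w p = pair_height w p by rewrite /excess subr0 max_l.
have tot i : total_excess 0 i p = 1.
  by rewrite /total_excess !ex /pair_height /height /=; lra.
rewrite -[RHS]hsubmxK /squeeze; congr (row_mx _ _); apply/rowP => i.
  by rewrite !mxE tot divr1 ex /pair_height /height /= !mxE.
by rewrite !mxE tot divr1 !ex /pair_height /height /= !mxE; lra.
Qed.

Lemma excess_continuous P w :
  continuous (fun p => excess (Num.max 0 (gap P p)) w p).
Proof.
move=> p.
apply: (@continuous_max _ _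
  (fun p => pair_height w p - Num.max 0 (gap P p)) (cst 0));
  last exact: cst_continuous.
apply: (@continuousB _ _ _ (pair_height w) (fun p => Num.max 0 (gap P p))).
  exact: pair_height_continuous.
apply: (@continuous_max _ _ (cst 0) (gap P)); first exact: cst_continuous.
exact: gap_continuous.
Qed.

Lemma retraction_continuous P p :
  collar P p -> {for p, continuous (retraction P)}.
Proof.
move=> /collar_small e3; have FF : Filter (nbhs p) by exact: nbhs_filter.
apply: cvg_rV => j.
have ct i : total_excess (Num.max 0 (gap P q)) i q @[q --> p] -->
    total_excess (Num.max 0 (gap P p)) i p.
  by apply: cvgD; [apply: cvgD|]; exact: excess_continuous.
have cti i : (total_excess (Num.max 0 (gap P q)) i q)^-1 @[q --> p] -->
    (total_excess (Num.max 0 (gap P p)) i p)^-1.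
  by apply: cvgV; [exact: lt0r_neq0 (total_excess_gt0 _ _ e3) | exact: ct].
rewrite /retraction /squeeze; case: (splitP j) => i ji;
  [have -> : j = lshift n.+1 i by exact: val_inj |
   have -> : j = rshift n.+1 i by exact: val_inj].
  under eq_cvg do rewrite row_mxEl mxE.
  rewrite row_mxEl mxE; apply: cvgM; last exact: cti.
  exact: excess_continuous.
under eq_cvg do rewrite row_mxEr mxE.
rewrite row_mxEr mxE; apply: cvgM; last exact: cti.
by apply: cvgD; exact: excess_continuous.
Qed.

(** A relatively open part of a neighbourhood retract is again one: restrict the
retraction to the preimage of [W]. *)
Lemma corner_complex_retract P (W : set V) : open W ->
  exists2 U : set V, open U & retract_of (corner_complex P `&` W) U.
Proof.
move=> oW; exists (collar P `&` (retraction P @^-1` W)).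
  rewrite openE => p [cp Wp]; apply: filterI.
    by have := @collar_open P; rewrite openE; apply.
  by apply: (retraction_continuous cp); move: oW; rewrite openE; apply.
split=> [p [hp Wp]|].
  split; last by rewrite /preimage /= retraction_id.
  by move: hp => /corner_complexP[_ g0]; rewrite /collar /=; lra.
exists (retraction P); split=> [|p [cp Wp]|p [hp _]].
- apply: continuous_in_subspaceT => p /set_mem[cp _].
  exact: retraction_continuous.
- by split=> //; exact: retraction_in.
- exact: retraction_id.
Qed.

End complexes.

(** * The two blocks *)

Section blocks.
Context (R : realType) (n : nat).
Local Notation V := 'rV[R]_(n.+1 + n.+1).
Local Notation S := (cube_boundary R n).
Implicit Types (p : S * S) (q : V) (rk : 'I_n.+1 -> 'I_n.+1).

Definition pair_vector p : V := row_mx (set_val p.1) (set_val p.2).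

Definition any_flow : rel (wall n) :=
  fun v w => flow id v w || flow (@rev_ord n.+1) v w.

Lemma pair_height_ge0 q : (forall w, 0 <= pair_height w q) <->
  forall i, [/\ 0 <= lsubmx q ord0 i, lsubmx q ord0 i <= rsubmx q ord0 i
            & rsubmx q ord0 i <= 1].
Proof.
rewrite /pair_height /height; split=> [h i|h [i [[]|]] /=].
- have := h (i, Some false); have := h (i, None); have := h (i, Some true).
  by move=> /=; rewrite !subr_ge0.
- by have [_ _] := h i; rewrite subr_ge0.
- by have [] := h i.
- by have [_ + _] := h i; rewrite subr_ge0.
Qed.

Lemma ascent_corner_complex rk p :
  ascent rk p <-> corner_complex (flow rk) (pair_vector p).
Proof.
rewrite /ascent /corner_complex /pair_vector /= row_mxKl row_mxKr.
split=> -[h hc]; split=> //; last first.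
  move=> i; have /pair_height_ge0/(_ i) := h.
  by rewrite row_mxKl row_mxKr => -[].
apply/pair_height_ge0 => i; rewrite row_mxKl row_mxKr; split=> //.
  by have /andP[] := coordinate_bound i p.1.
by have /andP[] := coordinate_bound i p.2.
Qed.

Lemma corner_complex_any_flow q : corner_complex any_flow q <->
  corner_complex (flow id) q \/ corner_complex (flow (@rev_ord n.+1)) q.
Proof.
split=> [[h [v [w [/orP[fl|fl] hv hw]]]]|[]].
- by left; split=> //; exists v, w.
- by right; split=> //; exists v, w.
- move=> [h [v [w [fl hv hw]]]]; split=> //; exists v, w.
  by rewrite /any_flow fl.
- move=> [h [v [w [fl hv hw]]]]; split=> //; exists v, w.
  by rewrite /any_flow fl orbT.
Qed.

Lemma reach_corner_complex p :
  reach (dsphere R n) p <-> corner_complex any_flow (pair_vector p).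
Proof.
apply: (iff_trans (reachP p)).
apply: iff_trans (iff_sym (corner_complex_any_flow _)).
by split=> -[] h; [left|right|left|right]; apply/ascent_corner_complex.
Qed.

Lemma corner_complex_boundary q : corner_complex any_flow q ->
  cube_boundary R n (lsubmx q) /\ cube_boundary R n (rsubmx q).
Proof.
move=> /corner_complex_any_flow hq.
have h0 i : [/\ 0 <= lsubmx q ord0 i, lsubmx q ord0 i <= rsubmx q ord0 i
            & rsubmx q ord0 i <= 1].
  by case: hq => -[/pair_height_ge0 + _]; apply.
have [rk /corner_flowP fl] : exists rk, corner (flow rk) (lsubmx q) (rsubmx q).
  by case: hq => -[_ fl]; [exists id | exists (@rev_ord n.+1)].
split; apply/cube_boundaryP; split.
- by move=> i; have [a b c] := h0 i; rewrite a (le_trans b c).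
- by case: fl => [[i [_ xi]]|[i [j [_ xi _]]]]; exists i; [|left].
- by move=> i; have [a b c] := h0 i; rewrite c (le_trans a b).
- by case: fl => [[i [-> xi]]|[i [j [_ _ yj]]]]; [exists i|exists j; right].
Qed.

Lemma pair_vector_continuous : continuous pair_vector.
Proof.
move=> p; have FF : Filter (nbhs p) by exact: nbhs_filter.
apply: cvg_rV => k; rewrite /pair_vector; case: (splitP k) => i ki;
  [have -> : k = lshift n.+1 i by exact: val_inj |
   have -> : k = rshift n.+1 i by exact: val_inj].
  under eq_cvg do rewrite row_mxEl.
  rewrite row_mxEl; apply: (@continuous_comp _ _ _ fst (coordinate i)).
    exact: cvg_fst.
  exact: coordinate_continuous.
under eq_cvg do rewrite row_mxEr.
rewrite row_mxEr; apply: (@continuous_comp _ _ _ snd (coordinate i)).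
  exact: cvg_snd.
exact: coordinate_continuous.
Qed.

Lemma lsubmx_continuous : continuous (fun q => lsubmx q).
Proof.
move=> q; have FF : Filter (nbhs q) by exact: nbhs_filter.
apply: cvg_rV => i; under eq_cvg do rewrite mxE.
by rewrite mxE; exact: coord_continuous.
Qed.

Lemma rsubmx_continuous : continuous (fun q => rsubmx q).
Proof.
move=> q; have FF : Filter (nbhs q) by exact: nbhs_filter.
apply: cvg_rV => i; under eq_cvg do rewrite mxE.
by rewrite mxE; exact: coord_continuous.
Qed.

(** The set [A] of pairs of points of the sphere is homeomorphic to its image in
the space of concatenated vectors; the inverse map cuts a vector in two. *)
Lemma ENR_block (A : set (reach (dsphere R n))) (Y : set V) :
  (forall a, A a <-> Y (pair_vector (set_val a))) ->
  Y `<=` corner_complex any_flow ->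
  (exists2 U : set V, open U & retract_of Y U) -> ENR R A.
Proof.
move=> AY YK retr; exists (n.+1 + n.+1)%N, Y; split=> //.
have fY (a : A) : pair_vector (set_val (set_val a)) \in Y.
  by apply/mem_set/AY; exact: set_valP.
pose f (a : A) : Y := exist _ (pair_vector (set_val (set_val a))) (fY a).
have lY (y : Y) : lsubmx (set_val y) \in S.
  by apply/mem_set; have [] := corner_complex_boundary (YK _ (set_valP y)).
have rY (y : Y) : rsubmx (set_val y) \in S.
  by apply/mem_set; have [] := corner_complex_boundary (YK _ (set_valP y)).
pose l y : S := exist _ (lsubmx (set_val y)) (lY y).
pose r y : S := exist _ (rsubmx (set_val y)) (rY y).
have lrK y : pair_vector (l y, r y) = set_val y by exact: hsubmxK.
have gR y : (l y, r y) \in reach (dsphere R n).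
  by apply/mem_set/reach_corner_complex; rewrite lrK; apply/YK; exact: set_valP.
pose g0 y : reach (dsphere R n) := exist _ (l y, r y) (gR y).
have gA y : g0 y \in A.
  by apply/mem_set/AY; rewrite [X in Y X](lrK y); exact: set_valP.
pose g y : A := exist _ (g0 y) (gA y).
exists f, g; split.
- apply: continuous_comp_initial => a.
  apply: (@continuous_comp _ _ _
      (fun a : A => set_val (set_val a)) pair_vector);
    last exact: pair_vector_continuous.
  by apply: (@continuous_comp _ _ _ set_val set_val); exact: initial_continuous.
- apply: continuous_comp_initial; apply: continuous_comp_initial.
  apply: (@continuous_pair _ _ _ l r); apply: continuous_comp_initial => y.
    apply: (@continuous_comp _ _ _ set_val (fun q : V => lsubmx q)).
      exact: initial_continuous.
    exact: lsubmx_continuous.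
  apply: (@continuous_comp _ _ _ set_val (fun q : V => rsubmx q)).
    exact: initial_continuous.
  exact: rsubmx_continuous.
- move=> a; apply: val_inj; apply: val_inj.
  rewrite /= [RHS]surjective_pairing; congr (_, _); apply: val_inj.
    exact: row_mxKl.
  exact: row_mxKr.
- by move=> y; apply: val_inj; exact: lrK.
Qed.

Definition forward_block : set (reach (dsphere R n)) :=
  [set a : reach (dsphere R n) | ascent id (set_val a)].

Lemma forward_block_ENR : ENR R forward_block.
Proof.
apply: (@ENR_block _ (corner_complex (flow id) `&` setT)).
- by move=> p; rewrite setIT; exact: ascent_corner_complex.
- by move=> q [hq _]; apply/corner_complex_any_flow; left.
- exact: corner_complex_retract openT.
Qed.

(** The reachable pairs outside the forward block are those with a positive gap
to it, which is an open condition. *)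
Lemma backward_block_ENR : ENR R (~` forward_block).
Proof.
pose W : set V := [set q | 0 < gap (flow id) q].
apply: (@ENR_block _ (corner_complex any_flow `&` W)).
- move=> p; have pK : corner_complex any_flow (pair_vector (set_val p)).
    by apply/reach_corner_complex; exact: set_valP.
  split=> [np|[_ Wp] /ascent_corner_complex/corner_complexP[_]]; last first.
    by rewrite leNgt Wp.
  split=> //; rewrite /W /= ltNge; apply/negP => g0; apply: np.
  apply/ascent_corner_complex/corner_complexP; split=> //.
  by have [] := pK.
- by move=> q [].
- apply: corner_complex_retract.
  apply: (@open_comp _ _ (gap (flow id)) [set t | 0 < t]); last exact: open_gt.
  by move=> q _; exact: gap_continuous.
Qed.

Lemma forward_block_section : has_section forward_block.
Proof. by apply: (@has_section_ascent _ _ id). Qed.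

Lemma backward_block_section : has_section (~` forward_block).
Proof.
apply: (@has_section_ascent _ _ (@rev_ord n.+1)) => p np.
by have /reachP[] := set_valP p.
Qed.

Context (n_gt0 : (0 < n)%N).

Lemma dTC_partition2 : dTC_partition (dsphere R n) 2.
Proof.
exists (fun i : 'I_2 => if i == ord0 then forward_block else ~` forward_block).
split=> [|i|i]; first split.
- apply/seteqP; split=> // p _; have [pf|pf] := pselect (forward_block p).
    by exists ord0.
  by exists ord_max.
- move=> i j _ _ [p]; case: ifPn => [/eqP->|i0]; case: ifPn => [/eqP->|j0] [].
  + by [].
  + by [].
  + by [].
  + move=> _ _; apply/val_inj.
    by case: i j i0 j0 => [[|[]]] //= ? [[|[]]].
(* if one block were empty, the section over the other one would be global *)
- move=> i _; apply/set0P/eqP => e.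
  apply: (no_global_section n_gt0 (R := R)); move: e; case: ifPn => _ e.
    by rewrite -setC0 -e; exact: backward_block_section.
  by rewrite -setC0 -e setCK; exact: forward_block_section.
- by case: ifP => _; [exact: forward_block_ENR | exact: backward_block_ENR].
- case: ifP => _; first exact: forward_block_section.
  exact: backward_block_section.
Qed.

Lemma dTC_partition_ge2 k : dTC_partition (dsphere R n) k -> (2 <= k)%N.
Proof.
case: k => [|[|//]] [A [[cA _ _] _ sA]]; exfalso.
  have : [set: reach (dsphere R n)] (probe n_gt0 ord0 0) by [].
  by rewrite -cA => -[[]].
apply: (no_global_section n_gt0 (R := R)); rewrite -cA.
suff -> : cover [set: 'I_1] A = A ord0 by exact: sA.
apply/seteqP; split=> [p [i _]|p Ap]; first by rewrite ord1.
by exists ord0.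
Qed.

End blocks.

(** * The complexity *)

Theorem mainTheorem1 (R : realType) (n : nat) (hn : (1 <= n)%N) :
  dTC (dsphere R n) = Some 2%N.
Proof.
have p2 : dTC_partitionb (dsphere R n) 2 by apply/asboolP/dTC_partition2.
rewrite /dTC; case: pselect => [ex|[]]; last by exists 2%N.
congr Some; case: ex_minnP => k /asboolP pk mink; apply/eqP.
by rewrite eqn_leq mink //= (dTC_partition_ge2 hn pk).
Qed.
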